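(* Let $1<p<\frac{3}{2}$, and let $X_1=\frac{\partial}{\partial x_1}$, $X_2=\frac{\partial}{\partial x_2}$ and $X_3=(x_1^2+x_2^2+x_1x_2)\frac{\partial}{\partial x_3}$ on $\mathbb{R}^3$, with $X=(X_1,X_2,X_3)$. Let $u_0\in L^1_{\mathrm{loc}}(\mathbb{R}^3)$. If $f\in L^1_{\mathrm{loc}}(\mathbb{R}^3)$ with $\int_{\mathbb{R}^3}f(x)\,dx>0$, then the problem $u_t-\Delta_X u=|u|^p+f(x)$ in $(0,\infty)\times\mathbb{R}^3$, $u(0,x)=u_0(x)$, does not admit a global in time weak solution.
   Context: For a system $X=(X_1,\dots,X_m)$ of real $C^\infty$ vector fields, $\Delta_X=-\sum_{k=1}^m X_k^\ast X_k$ with $X_k^\ast=-X_k-\operatorname{div}X_k$; here the vector fields are divergence free, so $\Delta_X=X_1^2+X_2^2+X_3^2$. Weak solution (with $n=3$): for $f,u_0\in L^1_{\mathrm{loc}}(\mathbb{R}^n)$, a function $u\in L^p_{\mathrm{loc}}((0,T),L^p_{\mathrm{loc}}(\mathbb{R}^n))$ is a local in time weak solution (on $[0,T)$) of $u_t-\Delta_X u=|u|^p+f(x)$, $u(0,x)=u_0(x)$, if for every non-negative test function $\psi\in C^1_c([0,T);C^2_c(\mathbb{R}^n))$ one has $\int_0^T\!\int_{\mathbb{R}^n}|u|^p\psi+\int_{\mathbb{R}^n}u_0\psi(0,x)+\int_0^T\!\int_{\mathbb{R}^n}f\psi+\int_0^T\!\int_{\mathbb{R}^n}u\psi_t+\int_0^T\!\int_{\mathbb{R}^n}u\,\Delta_X\psi=0$.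 When $T=\infty$, such $u$ is called a global in time weak solution. *)

(* Defs.v *)
From HB Require Import structures.
From mathcomp Require Import all_boot all_order all_algebra.
From mathcomp Require Import all_classical all_reals all_analysis.
Set Implicit Arguments.
Unset Strict Implicit.
Unset Printing Implicit Defensive.
Import Order.TTheory GRing.Theory Num.Theory.
Import numFieldNormedType.Exports.
Local Open Scope classical_set_scope.
Local Open Scope ring_scope.

(* R^3 is R * R * R, that is, (x1, x2, x3) is ((x1, x2), x3); its topology is
   the product topology. *)
Notation R3 R := (R * R * R)%type.

(* The same carrier, with the product of the Borel sigma-algebras that
   lebesgue_measure is defined on. *)
Notation mR3 R :=
  (measurableTypeR R * measurableTypeR R * measurableTypeR R)%type.

(* The library does not infer the sigma-finite structure of m1 \x m2. *)
Lemma product_sigma_finite d1 d2 (T1 : measurableType d1)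
    (T2 : measurableType d2) (R : realType)
    (m1 : {sigma_finite_measure set T1 -> \bar R})
    (m2 : {sigma_finite_measure set T2 -> \bar R}) :
  sigma_finite setT (m1 \x m2)%E.
Proof.
have /sigma_finiteP[F [TF ndF Foo]] := sigma_finiteT m1.
have /sigma_finiteP[G [TG ndG Goo]] := sigma_finiteT m2.
exists (fun n => F n `*` G n).
  rewrite -setXTT TF TG predeqE => -[x y]; split.
    move=> [/= [n _ Fnx] [k _ Gky]]; exists (maxn n k) => //; split.
    - by move: x Fnx; exact/subsetPset/ndF/leq_maxl.
    - by move: y Gky; exact/subsetPset/ndG/leq_maxr.
  by move=> [n _ []/= ? ?]; split; exists n.
move=> k; have [? ?] := Foo k; have [? ?] := Goo k.
split; first exact: measurableX.
by rewrite product_measure1E// lte_mul_pinfty// ge0_fin_numE.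
Qed.

Section definitions.
Variable R : realType.
Implicit Types (phi f : R3 R -> R) (V : R3 R -> R3 R).
Implicit Types (X : seq (R3 R -> R3 R)) (x : R3 R).
Implicit Types (psi u : R -> R3 R -> R).
Implicit Types (T : \bar R) (p t : R).

Local Notation leb := (@lebesgue_measure R).

Definition leb2 : set (measurableTypeR R * measurableTypeR R) -> \bar R :=
  (leb \x leb)%E.

HB.instance Definition _ := Measure.on leb2.

Let leb2_sigma_finite : sigma_finite setT leb2.
Proof. exact: product_sigma_finite. Qed.

HB.instance Definition _ :=
  Measure_isSigmaFinite.Build _ _ _ leb2 leb2_sigma_finite.

Definition leb3 : set (mR3 R) -> \bar R := (leb2 \x leb)%E.

HB.instance Definition _ := Measure.on leb3.

Let leb3_sigma_finite : sigma_finite setT leb3.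
Proof. exact: product_sigma_finite. Qed.

HB.instance Definition _ :=
  Measure_isSigmaFinite.Build _ _ _ leb3 leb3_sigma_finite.

Definition coord3 (j : 'I_3) x : R := [:: x.1.1; x.1.2; x.2]`_j.

Definition basis3 (j : 'I_3) : R3 R :=
  ((j == 0 :> nat)%:R, (j == 1 :> nat)%:R, (j == 2 :> nat)%:R).

Definition partial (j : 'I_3) phi : R3 R -> R :=
  fun x => 'D_(basis3 j) phi x.

Definition partials (s : seq 'I_3) phi : R3 R -> R := foldr partial phi s.

(* The vector field V is the first order operator \sum_j V_j d/dx_j. *)
Definition vf_app V phi : R3 R -> R :=
  fun x => \sum_(j < 3) coord3 j (V x) * partial j phi x.

Definition vf_div V : R3 R -> R :=
  fun x => \sum_(j < 3) partial j (fun y => coord3 j (V y)) x.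

Definition vf_adj V phi : R3 R -> R :=
  fun x => - vf_app V phi x - vf_div V x * phi x.

Definition laplacian X phi : R3 R -> R :=
  fun x => - \sum_(V <- X) vf_adj V (vf_app V phi) x.

Definition C2 phi := forall s : seq 'I_3, (size s <= 2)%N ->
  continuous (partials s phi) /\
  ((size s < 2)%N -> forall j x, derivable (partials s phi) x (basis3 j)).

Definition cvg_C2 (F : set_system R) psi phi := forall s : seq 'I_3,
  (size s <= 2)%N ->
  {uniform, (fun t => partials s (psi t)) @ F --> partials s phi}.

Definition time T : set R := [set t | 0 <= t /\ (t%:E < T)%E].

(* psi \in C^1_c([0, T); C^2_c(R^3)).  Only the values of psi on [0, T[ matter.
   A compactly supported continuous curve in C^2_c(R^3) has its values
   supported in one compact set K, and for functions supported in K the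
   convergence in C^2_c(R^3) is cvg_C2. The derivative at 0 is one-sided. *)
Definition test_function T psi :=
  (exists b K, [/\ time T b, compact K &
     forall t x, time T t -> (b < t \/ ~ K x) -> psi t x = 0]) /\
  (forall t, time T t -> C2 (psi t)) /\
  exists dpsi : R -> R3 R -> R, forall t, time T t ->
    [/\ C2 (dpsi t),
        cvg_C2 (within (time T) t^')
          (fun s x => (psi s x - psi t x) / (s - t)) (dpsi t) &
        cvg_C2 (within (time T) (nbhs t)) dpsi (dpsi t)].

Definition L1loc f := measurable_fun [set: mR3 R] f /\
  forall K : set (R3 R), compact K ->
    (\int[leb3]_(x in K) `|f x|%:E < +oo)%E.

Definition otime T : set R := [set t | 0 < t /\ (t%:E < T)%E].

(* u \in L^p_loc((0, T), L^p_loc(R^3)). *)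
Definition Lploc T p u :=
  measurable_fun (otime T `*` setT : set (measurableTypeR R * mR3 R))
    (fun z => u z.1 z.2) /\
  forall (I : set R) (K : set (R3 R)),
    compact I -> I `<=` otime T -> compact K ->
    (\int[leb]_(t in I) \int[leb3]_(x in K) (`|u t x| `^ p)%:E < +oo)%E.

(* The integrals are extended real valued. In \bar R a sum is finite only when
   all its terms are, and the integral of a measurable function is finite only
   when the function is integrable: the identity below thus includes the
   convergence of its five (iterated) integrals. *)
Definition weak_solution X p f (u0 : R3 R -> R) T u :=
  Lploc T p u /\
  forall psi, test_function T psi ->
    (forall t x, time T t -> 0 <= psi t x) ->
    (\int[leb]_(t in otime T) \int[leb3]_x (`|u t x| `^ p * psi t x)%:E
     + \int[leb3]_x (u0 x * psi 0 x)%:E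
     + \int[leb]_(t in otime T) \int[leb3]_x (f x * psi t x)%:E
     + \int[leb]_(t in otime T) \int[leb3]_x
         (u t x * derive1 (fun s : R => psi s x) t)%:E
     + \int[leb]_(t in otime T) \int[leb3]_x
         (u t x * laplacian X (psi t) x)%:E
     = 0)%E.

Definition global_weak_solution X p f (u0 : R3 R -> R) u :=
  weak_solution X p f u0 +oo%E u.

Definition X1 : R3 R -> R3 R := fun=> (1, 0, 0).

Definition X2 : R3 R -> R3 R := fun=> (0, 1, 0).

Definition X3 : R3 R -> R3 R := fun x =>
  (0, 0, x.1.1 ^+ 2 + x.1.2 ^+ 2 + x.1.1 * x.1.2).

End definitions.

Arguments leb2 : clear implicits.
Arguments leb3 : clear implicits.
Arguments X1 : clear implicits.
Arguments X2 : clear implicits.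
Arguments X3 : clear implicits.

(* Main.v *)
Require Import Defs.
From HB Require Import structures.
From mathcomp Require Import all_boot all_order all_algebra.
From mathcomp Require Import all_classical all_reals all_analysis.
From mathcomp Require Import measurable_realfun ring lra.
Set Implicit Arguments.
Unset Strict Implicit.
Unset Printing Implicit Defensive.
Import Order.TTheory GRing.Theory Num.Theory.
Import numFieldNormedType.Exports.
Local Open Scope classical_set_scope.
Local Open Scope ring_scope.

(** A global solution is tested against [psi = W ^+ (n + 3)], where
    [W (t, x)] is the product of the truncated parabolas
    [max 0 (1 - ((t - 2 r^2) / r^2)^2)], [max 0 (1 - (x1 / r)^2)],
    [max 0 (1 - (x2 / r)^2)] and [max 0 (1 - (x3 / r^3)^2)].  The scaling is
    that of the dilations for which the three fields are homogeneous of degree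
    one, and the initial datum plays no role because [psi] vanishes near
    [t = 0].  On the support of [psi] both [psi_t] and the Laplacian of [psi]
    are [O(r^-2 W ^+ (n + 1))]; when [(n + 1) p >= n + 3], Young's inequality
    bounds their product with [|u|] by [|u|^p psi + O(r^(-2 p'))], with
    [p' = p / (p - 1)].  The term [|u|^p psi] cancels in the weak formulation,
    and as the support has volume of order [r^7],
    [r^2 \int f phi_r <= C r^(7 - 2 p')], where [phi_r] is the spatial factor
    of [psi].  Now [p' > 3] when [p < 3/2], hence [\int f phi_r] is [O(1 / r)],
    whereas by monotone convergence on the positive part of [f] it stays above
    a positive constant for [r] large. *)

(** * Truncated parabolas *)

Section relu.
Context {R : realType}.
Implicit Types (s y : R) (n : nat).

Definition relu y := Num.max 0 y.

Lemma relu_ge0 y : 0 <= relu y.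
Proof. by rewrite /relu le_max lexx. Qed.

Lemma relu_le y z : 0 <= z -> y <= z -> relu y <= z.
Proof. by move=> z0 yz; rewrite /relu ge_max z0. Qed.

Lemma continuous_relu : continuous relu.
Proof. by move=> y; apply: continuous_max; [exact: cvg_cst|exact: cvg_id]. Qed.

Lemma continuous_reluX n : continuous (fun z : R => relu z ^+ n).
Proof.
move=> y; apply: (@continuous_comp _ _ _ relu (fun z => z ^+ n)).
  exact: continuous_relu.
exact: exprn_continuous.
Qed.

(** Away from 0 the function is locally 0 or [z ^+ n.+2]. At 0 the difference quotient is
    [relu h ^+ n.+1], which tends to 0 by continuity because the exponent is positive. *)
Lemma is_derive_reluX n y :
  is_derive y 1 (fun z => relu z ^+ n.+2) (n.+2%:R * relu y ^+ n.+1).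
Proof.
have [y0|y0|->] := ltgtP y 0.
- rewrite /relu max_l ?(ltW y0)// expr0n mulr0.
  apply: (near_eq_is_derive (f := cst 0)).
  near=> z; rewrite max_l ?expr0n//=.
  by rewrite ltW//; near: z; exact: lt_nbhsl.
- have -> : n.+2%:R * relu y ^+ n.+1 = (n.+2%:R * y ^+ n.+1) *: 1 :> R.
    by rewrite /relu max_r ?(ltW y0)// scaler1.
  apply: (near_eq_is_derive (f := (@id R) ^+ n.+2)).
  near=> z; rewrite /relu max_r ?fctE//.
  by rewrite ltW//; near: z; exact: lt_nbhsr.
- rewrite {2}/relu maxxx expr0n mulr0.
  have E : (fun h : R => relu h ^+ n.+1) @ 0^' --> (0 : R).
    have := @continuous_reluX n.+1 0.
    rewrite /continuous_at {2}/relu maxxx expr0n => E.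
    exact: cvg_within_filter E.
  have F : (fun h : R => h^-1 *: (((fun z => relu z ^+ n.+2) \o shift 0) (h *: 1)
      - relu 0 ^+ n.+2)) @ 0^' --> (0 : R).
    apply: cvg_trans E; apply: near_eq_cvg; near=> h.
    have h0 : h != 0 by near: h; exact: nbhs_dnbhs_neq.
    rewrite /= addr0 {3}/relu maxxx expr0n subr0 !scaler1 /GRing.scale/= /relu.
    have [_|_] := leP 0 h; last by rewrite !expr0n mulr0.
    by rewrite [h ^+ n.+2]exprS mulrA mulVf// mul1r.
  by split; [apply/cvg_ex; exists 0|exact: (cvg_lim _ F)].
Unshelve. all: by end_near. Qed.

End relu.

(** * Bumps of one variable and their first two derivatives *)

Section bump.
Context {R : realType}.
Variables (n : nat) (c r : R).
Hypothesis r0 : 0 < r.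
Implicit Types s : R.

Definition dome s := relu (1 - ((s - c) / r) ^+ 2).

(** Two derivatives of the power [n + 3] still leave a factor [dome s ^+ n.+1], so the bump is of
    class C^2 and its derivatives are controlled by a power of [dome]. *)
Definition bump s := dome s ^+ n.+3.

Definition bump1 s := - (2 * n.+3%:R / r) * ((s - c) / r) * dome s ^+ n.+2.

Definition bump2 s :=
  (4 * n.+3%:R * n.+2%:R / r ^+ 2) * ((s - c) / r) ^+ 2 * dome s ^+ n.+1
  - (2 * n.+3%:R / r ^+ 2) * dome s ^+ n.+2.

Lemma dome_ge0 s : 0 <= dome s. Proof. exact: relu_ge0. Qed.

Lemma dome_le1 s : dome s <= 1.
Proof. by rewrite relu_le// gerBl sqr_ge0. Qed.

Lemma dome_supp s : dome s != 0 -> `|(s - c) / r| <= 1.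
Proof.
rewrite /dome /relu; case: (leP 0) => [h _|]; last by rewrite eqxx.
by rewrite -(@ler_pXn2r _ 2)// ?nnegrE// expr1n real_normK ?num_real// -subr_ge0.
Qed.

Lemma dome_eq0 s : r < `|s - c| -> dome s = 0.
Proof.
move=> h; apply/eqP; apply: contraTT h => /dome_supp.
by rewrite normrM normfV (gtr0_norm r0) ler_pdivrMr// mul1r -leNgt.
Qed.

Lemma is_derive_affine s : is_derive s 1 (fun z => (z - c) / r) r^-1.
Proof.
have -> : (fun z => (z - c) / r) = r^-1 *: (id - cst c).
  by apply/funext => z; rewrite !fctE mulrC.
by apply: is_derive_eq; rewrite subr0 scaler1.
Qed.

Lemma is_derive_domeX k s :
  is_derive s 1 (fun z => dome z ^+ k.+2)
    (- (2 * k.+2%:R / r) * ((s - c) / r) * dome s ^+ k.+1).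
Proof.
have ds := is_derive_affine s.
have dg : is_derive s 1 (fun z => 1 - ((z - c) / r) ^+ 2) (- (2 / r * ((s - c) / r))).
  have -> : (fun z => 1 - ((z - c) / r) ^+ 2) = cst 1 - (fun z => (z - c) / r) ^+ 2.
    by apply/funext => z; rewrite !fctE.
  apply: is_derive_eq; rewrite sub0r expr1 /GRing.scale/=; ring.
have := @is_derive1_comp _ _ _ s _ _ (is_derive_reluX k _) dg.
rewrite /comp /dome => h; apply: (is_derive_eq h); rewrite /GRing.scale/=; ring.
Qed.

Lemma is_derive_bump s : is_derive s 1 bump (bump1 s).
Proof. exact: is_derive_domeX. Qed.

Lemma is_derive_bump1 s : is_derive s 1 bump1 (bump2 s).
Proof.
have ds := is_derive_affine s; have dd := is_derive_domeX n s.
have -> : bump1 = (- (2 * n.+3%:R / r)) *: ((fun z => (z - c) / r) * (fun z => dome z ^+ n.+2)).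
  by apply/funext => z; rewrite !fctE /bump1 -mulrA.
apply: is_derive_eq; rewrite /bump2 /GRing.scale/= -/(dome s); field.
exact: lt0r_neq0.
Qed.

Lemma continuous_affine : continuous (fun s => (s - c) / r).
Proof.
move=> s; apply: cvgM; last exact: cvg_cst.
by apply: cvgB; [exact: cvg_id|exact: cvg_cst].
Qed.

Lemma continuous_affineX k : continuous (fun s => ((s - c) / r) ^+ k).
Proof.
move=> s; apply: (@continuous_comp _ _ _ (fun z => (z - c) / r) (fun z => z ^+ k)).
  exact: continuous_affine.
exact: exprn_continuous.
Qed.

Lemma continuous_domeX k : continuous (fun s => dome s ^+ k).
Proof.
move=> s; apply: (@continuous_comp _ _ _ (fun z => 1 - ((z - c) / r) ^+ 2)
  (fun z => relu z ^+ k)); last exact: continuous_reluX.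
by apply: cvgB; [exact: cvg_cst|exact: continuous_affineX].
Qed.

Lemma continuous_bump : continuous bump.
Proof. exact: continuous_domeX. Qed.

Lemma continuous_bump1 : continuous bump1.
Proof.
move=> s; apply: cvgM; last exact: continuous_domeX.
by apply: cvgM; [exact: cvg_cst|exact: continuous_affine].
Qed.

Lemma continuous_bump2 : continuous bump2.
Proof.
move=> s; apply: cvgB; apply: cvgM; try exact: continuous_domeX.
  by apply: cvgM; [exact: cvg_cst|exact: continuous_affineX].
exact: cvg_cst.
Qed.

Lemma domeX_le m k s : (m <= k)%N -> dome s ^+ k <= dome s ^+ m.
Proof. by move=> mk; apply: ler_wiXn2l; rewrite // ?dome_ge0 ?dome_le1. Qed.

(** With [N = n + 3], the coefficients are [2 N] in [bump1] and at most [4 N (N - 1) + 2 N] in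
    [bump2]; [6 N^2] dominates both. *)
Definition bumpC : R := 6 * n.+3%:R ^+ 2.

(** The linear factor is at most 1 where [dome] is nonzero, and elsewhere both sides vanish. *)
Lemma normr_domeX_dome k s : `|(s - c) / r| * dome s ^+ k.+1 <= dome s ^+ k.+1.
Proof.
have [->|d0] := eqVneq (dome s) 0; first by rewrite expr0n mulr0.
by rewrite ler_piMl ?exprn_ge0 ?dome_ge0// dome_supp.
Qed.

Lemma bump_ge0 s : 0 <= bump s. Proof. exact/exprn_ge0/dome_ge0. Qed.

Lemma bump_bound s : `|bump s| <= dome s ^+ n.+1.
Proof. by rewrite ger0_norm ?bump_ge0//; apply: domeX_le; exact: leqW. Qed.

Lemma bump1_bound s : `|bump1 s| <= bumpC / r * dome s ^+ n.+1.
Proof.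
have n3 : 1 <= n.+3%:R :> R by rewrite ler1n.
have D0 := exprn_ge0 n.+2 (dome_ge0 s).
have r1 : 0 <= r^-1 by rewrite invr_ge0 ltW.
have a0 : 0 <= 2 * n.+3%:R / r by rewrite mulr_ge0// mulr_ge0.
rewrite /bump1 -(mulrA (- _)) normrM normrN (ger0_norm a0).
apply: ler_pM; rewrite ?mulr_ge0//.
  by rewrite ler_wpM2r// /bumpC; nra.
rewrite normrM [X in _ * X]ger0_norm// (le_trans (normr_domeX_dome _ _))//.
exact: domeX_le.
Qed.

Lemma bump2_bound s : `|bump2 s| <= bumpC / r ^+ 2 * dome s ^+ n.+1.
Proof.
rewrite /bump2.
have n3 : 1 <= n.+3%:R :> R by rewrite ler1n.
have n23 : n.+2%:R <= n.+3%:R :> R by rewrite ler_nat.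
have n20 : 0 <= n.+2%:R :> R by [].
have D0 := exprn_ge0 n.+1 (dome_ge0 s).
have E0 := exprn_ge0 n.+2 (dome_ge0 s).
have ED : dome s ^+ n.+2 <= dome s ^+ n.+1 by exact: domeX_le.
have YD : ((s - c) / r) ^+ 2 * dome s ^+ n.+1 <= dome s ^+ n.+1.
  rewrite -real_normK ?num_real// expr2 -mulrA (le_trans _ (normr_domeX_dome n s))//.
  by rewrite ler_wpM2l// normr_domeX_dome.
have Y0 : 0 <= ((s - c) / r) ^+ 2 * dome s ^+ n.+1 by rewrite mulr_ge0// sqr_ge0.
have r2 : 0 <= (r ^+ 2)^-1 by rewrite invr_ge0 exprn_ge0// ltW.
rewrite -(mulrA _ (_ ^+ 2)).
set Y := (_ ^+ 2 * _) in YD Y0 *.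
set D := dome s ^+ n.+1 in D0 ED YD *.
set E := dome s ^+ n.+2 in E0 ED *.
set N := n.+3%:R in n3 n23 *.
rewrite (_ : _ - _ = (4 * N * n.+2%:R * Y - 2 * N * E) / r ^+ 2); last by ring.
rewrite normrM (ger0_norm r2) [leRHS]mulrAC ler_wpM2r// /bumpC -/N ler_norml.
have N0 : 0 <= N by exact: le_trans n3.
have NN : N <= N * N by rewrite ler_peMl.
have H1 : 4 * N * n.+2%:R * Y <= 4 * (N * N) * D.
  have NN2 : N * n.+2%:R <= N * N by rewrite ler_wpM2l.
  rewrite -(mulrA 4); apply: ler_pM => //; first by rewrite !mulr_ge0.
  by rewrite ler_wpM2l.
have H2 : 2 * N * E <= 2 * (N * N) * D.
  by apply: ler_pM => //; [rewrite mulr_ge0|rewrite ler_wpM2l].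
have H3 : 0 <= 4 * N * n.+2%:R * Y by do 3!rewrite mulr_ge0//.
have H4 : 0 <= 2 * N * E by do 2!rewrite mulr_ge0//.
have H5 : 0 <= N * N * D by do 2!rewrite mulr_ge0//.
by apply/andP; split; lra.
Qed.

End bump.

(** * Products of functions of one variable *)

Section tensor.
Context {R : realType}.
Implicit Types (x v : R3 R) (s d e : R) (a b c g : R -> R) (phi : R3 R -> R).
Implicit Types A B C : nat -> R -> R.

Definition tensor a b c : R3 R -> R := fun x => a x.1.1 * b x.1.2 * c x.2.

(** Along the line through [x] with direction [v], [phi] is a translate of [g], so the two
    difference quotients coincide. This reduces partial derivatives on the space to derivatives of
    one variable. *)
Lemma is_derive_line phi g x v s d :
    (forall h, phi (h *: v + x) = g (h + s)) ->
  is_derive s 1 g d -> is_derive x v phi d.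
Proof.
move=> pg; have p0 : phi x = g s by have := pg 0; rewrite scale0r !add0r.
have E : (fun h : R => h^-1 *: ((phi \o shift x) (h *: v) - phi x)) =
  (fun h : R => h^-1 *: ((g \o shift s) (h *: 1) - g s)).
  by apply/funext => h /=; rewrite pg p0 scaler1.
by case=> dg vg; split; rewrite /derivable ?/derive E.
Qed.

Lemma partial_is_derive phi (D : R3 R -> R) j :
  (forall x, is_derive x (basis3 R j) phi (D x)) -> partial j phi = D.
Proof. by move=> h; apply/funext => x; rewrite /partial; apply: derive_val. Qed.

(** The list [s] plays the part of a multi-index; this is its order in the coordinate [i]. *)
Definition coord_count (i : nat) (s : seq 'I_3) := count (fun j : 'I_3 => j == i :> nat) s.

(* [A 0], [A 1], [A 2] are a bounded C^2 function and its two derivatives. *)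
Definition jet2 A :=
  [/\ forall i, (i < 2)%N -> forall s, is_derive s 1 (A i) (A i.+1 s),
      forall i, (i <= 2)%N -> continuous (A i) &
      exists M, forall i, (i <= 2)%N -> forall s, `|A i s| <= M].

(* The iterated partial derivative along [s] of [tensor (A 0) (B 0) (C 0)]. *)
Definition jtensor A B C (s : seq 'I_3) : R3 R -> R :=
  tensor (A (coord_count 0 s)) (B (coord_count 1 s)) (C (coord_count 2 s)).

Lemma is_derive_jtensor A B C (s : seq 'I_3) j x : jet2 A -> jet2 B -> jet2 C ->
  (size s < 2)%N ->
  is_derive x (basis3 R j) (jtensor A B C s) (jtensor A B C (j :: s) x).
Proof.
move=> [dA _ _] [dB _ _] [dC _ _] s2.
have cs i : (coord_count i s < 2)%N by rewrite (leq_ltn_trans _ s2)// count_size.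
case: x => -[x y] z.
case: j => -[|[|[|//]]] j3.
- pose g := (B (coord_count 1 s) y * C (coord_count 2 s) z) *: A (coord_count 0 s).
  apply: (@is_derive_line _ g _ _ x).
    move=> h; rewrite /jtensor /tensor /= /g !fctE /GRing.scale/= !mulr1 !mulr0 !add0r; ring.
  have dg := dA _ (cs 0%N) x.
  rewrite /g; apply: is_derive_eq.
  rewrite /jtensor /tensor/= /GRing.scale/= add1n add0n; ring.
- pose g := (A (coord_count 0 s) x * C (coord_count 2 s) z) *: B (coord_count 1 s).
  apply: (@is_derive_line _ g _ _ y).
    move=> h; rewrite /jtensor /tensor /= /g !fctE /GRing.scale/= !mulr1 !mulr0 !add0r; ring.
  have dg := dB _ (cs 1%N) y.
  rewrite /g; apply: is_derive_eq.
  rewrite /jtensor /tensor/= /GRing.scale/= add1n add0n; ring.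
- pose g := (A (coord_count 0 s) x * B (coord_count 1 s) y) *: C (coord_count 2 s).
  apply: (@is_derive_line _ g _ _ z).
    move=> h; rewrite /jtensor /tensor /= /g !fctE /GRing.scale/= !mulr1 !mulr0 !add0r; ring.
  have dg := dC _ (cs 2%N) z.
  rewrite /g; apply: is_derive_eq.
  rewrite /jtensor /tensor/= /GRing.scale/= add1n add0n; ring.
Qed.

Lemma partials_jtensor A B C (s : seq 'I_3) : jet2 A -> jet2 B -> jet2 C ->
  (size s <= 2)%N -> partials s (jtensor A B C [::]) = jtensor A B C s.
Proof.
move=> jA jB jC; elim: s => // j s IHs s2.
rewrite [LHS]/= IHs; last exact: ltnW.
by apply: partial_is_derive => x; exact: is_derive_jtensor.
Qed.

Lemma continuous_tensor a b c :
  continuous a -> continuous b -> continuous c -> continuous (tensor a b c).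
Proof.
move=> ca cb cc x.
have c11 : {for x, continuous (fun x : R3 R => x.1.1)}.
  by apply: (@continuous_comp _ _ _ fst fst); exact: cvg_fst.
have c12 : {for x, continuous (fun x : R3 R => x.1.2)}.
  by apply: (@continuous_comp _ _ _ fst snd); [exact: cvg_fst|exact: cvg_snd].
have c2 : {for x, continuous (fun x : R3 R => x.2)} by exact: cvg_snd.
apply: cvgM; [apply: cvgM|].
- exact: (continuous_comp c11 (ca _)).
- exact: (continuous_comp c12 (cb _)).
- exact: (continuous_comp c2 (cc _)).
Qed.

Lemma C2_jtensor A B C : jet2 A -> jet2 B -> jet2 C -> C2 (jtensor A B C [::]).
Proof.
move=> jA jB jC s s2; rewrite partials_jtensor//; split.
  have cs i : (coord_count i s <= 2)%N by rewrite (leq_trans _ s2)// count_size.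
  case: jA jB jC => [_ cA _] [_ cB _] [_ cC _].
  by apply: continuous_tensor; [exact: cA|exact: cB|exact: cC].
by move=> s1 j x; apply: ex_derive; exact: is_derive_jtensor.
Qed.

Lemma jet2Z e A : jet2 A -> jet2 (fun i s => e * A i s).
Proof.
move=> [dA cA [M AM]]; split.
- move=> i i2 s; have d := dA i i2 s.
  rewrite (_ : (fun s => _) = e *: A i); last by apply/funext.
  exact: is_derive_eq.
- move=> i i2 s; apply: cvgM; [exact: cvg_cst|exact: cA].
- exists (`|e| * M) => i i2 s; rewrite normrM ler_wpM2l//; exact: AM.
Qed.

Lemma jtensorZ e A B C (s : seq 'I_3) :
  (fun x => e * jtensor A B C s x) = jtensor (fun i s => e * A i s) B C s.
Proof. by apply/funext => x; rewrite /jtensor /tensor !mulrA. Qed.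

(** Every partial derivative of order at most two is [e t] times a fixed bounded function, so
    convergence of the scalars [e t] gives uniform convergence. *)
Lemma cvg_C2_jtensor (F : set_system R) (e : R -> R) (l : R) A B C : Filter F ->
  jet2 A -> jet2 B -> jet2 C -> e @ F --> l ->
  cvg_C2 F (fun t x => e t * jtensor A B C [::] x) (fun x => l * jtensor A B C [::] x).
Proof.
move=> FF jA jB jC el s s2.
have E k : partials s (fun x => k * jtensor A B C [::] x) = fun x => k * jtensor A B C s x.
  by rewrite jtensorZ partials_jtensor// -?jtensorZ//; exact: jet2Z.
rewrite E (_ : (fun t => _) = (fun t x => e t * jtensor A B C s x)); last first.
  by apply/funext => t.
have [M [M0 JM]] : exists M, 0 < M /\ forall x, `|jtensor A B C s x| <= M.
  have cs i : (coord_count i s <= 2)%N by rewrite (leq_trans _ s2)// count_size.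
  case: jA jB jC => [_ _ [MA cA]] [_ _ [MB cB]] [_ _ [MC cC]].
  (* The summand 1 makes the bound positive, so that the radius can be divided by it. *)
  exists (`|MA| * `|MB| * `|MC| + 1); split; first by rewrite ltr_pwDr ?mulr_ge0.
  move=> x; rewrite /jtensor /tensor !normrM ler_wpDr//.
  have H (m : R) k : k <= m -> k <= `|m| by move=> km; rewrite (le_trans km)// ler_norm.
  by apply: ler_pM; rewrite ?mulr_ge0//; [apply: ler_pM => //|];
    apply: H; [exact: cA|exact: cB|exact: cC].
move=> P /uniform_nbhs[V [entV VP]].
move: entV; rewrite -entourage_ballE => -[r /= r0 rV].
have rM : 0 < r / M by rewrite divr_gt0.
have /cvgrPdist_lt/(_ _ rM) := el.
apply: filterS => t lt; apply: VP => x _; apply: rV => /=.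
rewrite /ball/= -mulrBl normrM.
by rewrite (le_lt_trans (ler_wpM2l _ (JM x)))// -ltr_pdivlMr.
Qed.

End tensor.

(** * The operator [X1^2 + X2^2 + X3^2] on products *)

Section laplacian_jtensor.
Context {R : realType}.
Implicit Types (x : R3 R) (A B C : nat -> R -> R) (phi : R3 R -> R).

Definition coefX3 x : R := x.1.1 ^+ 2 + x.1.2 ^+ 2 + x.1.1 * x.1.2.

(** This applies to the coefficient of [X3]: it shows that [X3] is divergence free and that [X3]
    commutes with multiplication by its own coefficient. *)
Lemma partial2_cst (k : R -> R -> R) (x : R3 R) :
  is_derive x (basis3 R (lift ord0 (lift ord0 ord0))) (fun y => k y.1.1 y.1.2) 0.
Proof.
apply: (@is_derive_line _ _ (cst (k x.1.1 x.1.2)) _ _ x.2) => h.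
by rewrite /= /GRing.scale/= !mulr0 !add0r.
Qed.

Lemma vf_div_X1 x : vf_div (X1 R) x = 0.
Proof.
rewrite /vf_div big1// => j _; rewrite /partial.
by rewrite (_ : (fun y => _) = cst (coord3 j (1, 0, 0)))// derive_cst.
Qed.

Lemma vf_div_X2 x : vf_div (X2 R) x = 0.
Proof.
rewrite /vf_div big1// => j _; rewrite /partial.
by rewrite (_ : (fun y => _) = cst (coord3 j (0, 1, 0)))// derive_cst.
Qed.

Lemma vf_div_X3 x : vf_div (X3 R) x = 0.
Proof.
rewrite /vf_div !big_ord_recl big_ord0 addr0 /partial !derive_cst !add0r.
rewrite /coord3/=.
have := partial2_cst (fun a b => a ^+ 2 + b ^+ 2 + a * b) x.
by move=> h; exact: derive_val.
Qed.

Lemma vf_app_X1 phi : vf_app (X1 R) phi = partial ord0 phi.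
Proof.
apply/funext => x; rewrite /vf_app !big_ord_recl big_ord0 /coord3/=.
by rewrite mul1r !mul0r !addr0.
Qed.

Lemma vf_app_X2 phi : vf_app (X2 R) phi = partial (lift ord0 ord0) phi.
Proof.
apply/funext => x; rewrite /vf_app !big_ord_recl big_ord0 /coord3/=.
by rewrite mul1r !mul0r !addr0 add0r.
Qed.

Lemma vf_app_X3 phi : vf_app (X3 R) phi =
  fun x => coefX3 x * partial (lift ord0 (lift ord0 ord0)) phi x.
Proof.
apply/funext => x; rewrite /vf_app !big_ord_recl big_ord0 /coord3/=.
by rewrite !mul0r !addr0 !add0r.
Qed.

(** The divergences vanish, which leaves the sum of the three squares. As [coefX3] is constant in
    the third coordinate, [X3^2] is [coefX3 ^+ 2] times the second derivative in that coordinate. *)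
Lemma laplacian_jtensor A B C x : jet2 A -> jet2 B -> jet2 C ->
  laplacian [:: X1 R; X2 R; X3 R] (jtensor A B C [::]) x =
  tensor (A 2) (B 0%N) (C 0%N) x + tensor (A 0%N) (B 2) (C 0%N) x
  + coefX3 x ^+ 2 * tensor (A 0%N) (B 0%N) (C 2) x.
Proof.
move=> jA jB jC.
have P s j : (size s < 2)%N -> partial j (jtensor A B C s) = jtensor A B C (j :: s).
  by move=> s2; apply: partial_is_derive => y; exact: is_derive_jtensor.
rewrite /laplacian !big_cons big_nil /vf_adj vf_div_X1 vf_div_X2 vf_div_X3.
rewrite !mul0r !subr0 addr0 !vf_app_X1 !vf_app_X2 !vf_app_X3 !P//.
rewrite !opprD !opprK addrA; congr (_ + _).
set j2 := lift _ _.
have d2 := @is_derive_jtensor _ A B C [:: j2] j2 x jA jB jC isT.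
have dq : is_derive x (basis3 R j2) coefX3 0.
  exact: (partial2_cst (fun a b => a ^+ 2 + b ^+ 2 + a * b)).
have := is_deriveM dq d2.
rewrite /partial (_ : coefX3 * _ = (fun y => coefX3 y * jtensor A B C [:: j2] y))//.
by case => _ ->; rewrite scaler0 addr0 /GRing.scale/= mulrA.
Qed.

End laplacian_jtensor.

(** * The test functions *)

Section bump_jet.
Context {R : realType}.
Variables (n : nat) (c r : R).
Hypothesis r0 : 0 < r.

Definition bump_jet (i : nat) : R -> R :=
  if i is i'.+1 then if i' is 0%N then bump1 n c r else bump2 n c r
  else bump n c r.

Lemma jet2_bump : jet2 bump_jet.
Proof.
split.
- by case=> [|[|//]] _ s; [exact: is_derive_bump|exact: is_derive_bump1].
- case=> [|[|[|//]]] _; [exact: continuous_bump|exact: continuous_bump1|].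
  exact: continuous_bump2.
- have D s : dome c r s ^+ n.+1 <= 1 by rewrite exprn_ile1 ?dome_ge0 ?dome_le1.
  have C0 : 0 <= bumpC n :> R by rewrite mulr_ge0.
  have C1 : 0 <= bumpC n / r by rewrite divr_ge0// ltW.
  have C2 : 0 <= bumpC n / r ^+ 2 by rewrite divr_ge0// exprn_ge0// ltW.
  exists (1 + bumpC n / r + bumpC n / r ^+ 2) => -[|[|[|//]]] _ s /=.
  + by rewrite (le_trans (bump_bound _ _ _ _))// (le_trans (D _))// -addrA lerDl addr_ge0.
  + rewrite (le_trans (bump1_bound _ _ r0 _))// (le_trans (ler_wpM2l C1 (D s)))// mulr1; lra.
  + rewrite (le_trans (bump2_bound _ _ r0 _))// (le_trans (ler_wpM2l C2 (D s)))// mulr1; lra.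
Qed.

End bump_jet.

(** The difference quotient in [h] at 0 is moved to one in [s] at [t], the form in which
    [test_function] states differentiability in time. *)
Lemma cvg_slope {R : realType} (g : R -> R) (t d : R) : is_derive t 1 g d ->
  (fun s => (g s - g t) / (s - t)) @ t^' --> d.
Proof.
move=> [dg <-].
have st : (fun s : R => s - t) @ t^' --> 0^'.
  move=> P; rewrite /dnbhs /within/= => P0.
  have : (fun s : R => s - t) @ t --> (0 : R).
    by apply/subr_cvg0; exact: cvg_id.
  move=> /(_ _ P0) h0; have H : nbhs t [set s | s - t != 0 -> P (s - t)] by exact: h0.
  by apply: filterS H => s /= h st'; apply: h; rewrite subr_eq0.
have := cvg_comp _ _ st dg.
rewrite (_ : _ \o _ = fun s => (g s - g t) / (s - t))//.
by apply/funext => s /=; rewrite scaler1 subrK /GRing.scale/= mulrC.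
Qed.

Section test.
Context {R : realType}.
Variables (n : nat) (r : R).
Hypothesis r1 : 1 <= r.
Implicit Types (t : R) (x : R3 R).

Let r0 : 0 < r. Proof. exact: lt_le_trans r1. Qed.
Let r20 : 0 < r ^+ 2. Proof. exact: exprn_gt0. Qed.
Let r30 : 0 < r ^+ 3. Proof. exact: exprn_gt0. Qed.

(** Centre [2 r^2] and half-width [r^2] confine the support to [[r^2, 3 r^2]]. *)
Definition cutoff_t t := bump n (2 * r ^+ 2) (r ^+ 2) t.

(** The third width is [r^3] because the coefficient of [X3] is homogeneous of degree two: on the
    support [X3] then costs [r^2 r^-3 = r^-1], just as [X1] and [X2] do. *)
Definition cutoff_x := jtensor (bump_jet n 0 r) (bump_jet n 0 r) (bump_jet n 0 (r ^+ 3)) [::].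

Definition cutoff t x := cutoff_t t * cutoff_x x.

Definition box : set (R3 R) :=
  (`[- r, r]%classic `*` `[- r, r]%classic) `*` `[- r ^+ 3, r ^+ 3]%classic.

Lemma compact_box : compact box.
Proof. by do 2?apply: compact_setX; exact: segment_compact. Qed.

Definition dome_x x := dome 0 r x.1.1 * dome 0 r x.1.2 * dome 0 (r ^+ 3) x.2.

Lemma cutoff_xE x : cutoff_x x = dome_x x ^+ n.+3.
Proof. by rewrite /cutoff_x /jtensor /tensor /= /bump /dome_x !exprMn. Qed.

Lemma dome_x_out x : ~ box x -> dome_x x = 0.
Proof.
have H (s a : R) : 0 < s -> ~ `[- s, s]%classic a -> dome 0 s a = 0.
  move=> s0 h; apply: dome_eq0 => //; rewrite subr0 ltNge; apply/negP => sa; apply: h.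
  by rewrite /= in_itv/= -ler_norml.
rewrite /dome_x => h.
have [h1|h1] := pselect (`[- r, r]%classic x.1.1); last by rewrite (H _ _ r0 h1) !mul0r.
have [h2|h2] := pselect (`[- r, r]%classic x.1.2); last by rewrite (H _ _ r0 h2) mulr0 mul0r.
have [h3|h3] := pselect (`[- r ^+ 3, r ^+ 3]%classic x.2); last by rewrite (H _ _ r30 h3) mulr0.
by exfalso; apply: h.
Qed.

Lemma cutoff_t_out t : r ^+ 2 < `|t - 2 * r ^+ 2| -> cutoff_t t = 0.
Proof. by move=> h; rewrite /cutoff_t /bump dome_eq0// expr0n. Qed.

Let jx := @jet2_bump R n 0 r r0.
Let jz := @jet2_bump R n 0 (r ^+ 3) r30.

Lemma C2_scale (e : R) : C2 (fun x => e * cutoff_x x).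
Proof. by rewrite jtensorZ; apply: C2_jtensor => //; exact: jet2Z. Qed.

(** The cutoff is a scalar function of time multiplied by a fixed spatial profile, so its regularity
    as a curve reduces to that of the scalar factor. *)
Lemma test_cutoff : test_function +oo%E cutoff.
Proof.
split; [|split].
- exists (3 * r ^+ 2), box; split.
  + by rewrite /time/= mulr_ge0 ?(ltW r20) ?ltry.
  + exact: compact_box.
  + move=> t x _ [bt|nx]; rewrite /cutoff.
      by rewrite cutoff_t_out ?mul0r// ltr_normr; apply/orP; left; lra.
    by rewrite cutoff_xE dome_x_out// expr0n mulr0.
- by move=> t _; exact: C2_scale.
- exists (fun t x => bump1 n (2 * r ^+ 2) (r ^+ 2) t * cutoff_x x) => t _; split.
  + exact: C2_scale.
  + have := cvg_slope (@is_derive_bump R n (2 * r ^+ 2) (r ^+ 2) t) => h.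
    rewrite (_ : (fun s x => _) =
      fun s x => (cutoff_t s - cutoff_t t) / (s - t) * cutoff_x x); last first.
      by apply/funext => s; apply/funext => x; rewrite /cutoff -mulrBl mulrAC.
    apply: cvg_C2_jtensor => //.
    exact: cvg_within_filter h.
  + apply: cvg_C2_jtensor => //.
    apply: cvg_within_filter; exact: continuous_bump1.
Qed.

Lemma derive1_cutoff t x :
  derive1 (fun s : R => cutoff s x) t = bump1 n (2 * r ^+ 2) (r ^+ 2) t * cutoff_x x.
Proof.
have db := @is_derive_bump R n (2 * r ^+ 2) (r ^+ 2) t.
rewrite /cutoff derive1Mr; last by apply: ex_derive; exact: db.
by rewrite derive1E; congr (_ * _); apply: derive_val.
Qed.

Lemma laplacian_cutoff t x : laplacian [:: X1 R; X2 R; X3 R] (cutoff t) x =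
  cutoff_t t * (
   bump2 n 0 r x.1.1 * bump n 0 r x.1.2 * bump n 0 (r ^+ 3) x.2
 + bump n 0 r x.1.1 * bump2 n 0 r x.1.2 * bump n 0 (r ^+ 3) x.2
 + coefX3 x ^+ 2 * (bump n 0 r x.1.1 * bump n 0 r x.1.2 * bump2 n 0 (r ^+ 3) x.2)).
Proof.
rewrite /cutoff jtensorZ laplacian_jtensor//; last exact: jet2Z.
by rewrite /tensor/=; ring.
Qed.

Definition dome_tx t x := dome (2 * r ^+ 2) (r ^+ 2) t * dome_x x.

Lemma cutoffE t x : cutoff t x = dome_tx t x ^+ n.+3.
Proof. by rewrite /cutoff cutoff_xE -exprMn. Qed.

Lemma dome_x_ge0 x : 0 <= dome_x x.
Proof. by rewrite !mulr_ge0// dome_ge0. Qed.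

Lemma dome_x_le1 x : dome_x x <= 1.
Proof.
apply: mulr_ile1; rewrite ?mulr_ge0 ?dome_ge0 ?dome_le1//.
by apply: mulr_ile1; rewrite ?dome_ge0 ?dome_le1.
Qed.

Lemma dome_tx_ge0 t x : 0 <= dome_tx t x.
Proof. by rewrite mulr_ge0// ?dome_ge0// dome_x_ge0. Qed.

Lemma dome_tx_le1 t x : dome_tx t x <= 1.
Proof. by apply: mulr_ile1; rewrite ?dome_ge0 ?dome_le1 ?dome_x_ge0 ?dome_x_le1. Qed.

Lemma derive1_cutoff_bound t x : `|derive1 (fun s : R => cutoff s x) t| <=
  bumpC n / r ^+ 2 * dome_tx t x ^+ n.+1.
Proof.
rewrite derive1_cutoff normrM /dome_tx exprMn [leRHS]mulrA.
apply: ler_pM => //; first exact: bump1_bound.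
rewrite cutoff_xE ger0_norm ?exprn_ge0 ?dome_x_ge0//.
by apply: ler_wiXn2l; rewrite ?dome_x_ge0 ?dome_x_le1//; exact: leqW.
Qed.

(** Each of the three monomials of [coefX3] is at most [r^2] in absolute value on the box. *)
Lemma coefX3_bound x : box x -> coefX3 x ^+ 2 <= 9 * r ^+ 4.
Proof.
move=> [[/= b1 b2] _]; move: b1 b2; rewrite !in_itv/= /coefX3.
move: x => [[a b] c] /=; rewrite -!ler_norml => ar br.
have -> : 9 * r ^+ 4 = (3 * r ^+ 2) ^+ 2 by ring.
rewrite -[leLHS]real_normK ?num_real//; apply: lerXn2r; rewrite ?nnegrE//.
  by rewrite mulr_ge0// ltW.
have A : `|a ^+ 2| <= r ^+ 2 by rewrite normrX; apply: lerXn2r; rewrite ?nnegrE// ltW.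
have B : `|b ^+ 2| <= r ^+ 2 by rewrite normrX; apply: lerXn2r; rewrite ?nnegrE// ltW.
have C : `|a * b| <= r ^+ 2 by rewrite normrM expr2; apply: ler_pM.
rewrite (le_trans (ler_normD _ _))//.
have := ler_normD (a ^+ 2) (b ^+ 2); lra.
Qed.

(** The constant is [11 = 1 + 1 + 9]: [X1] and [X2] contribute [bumpC n / r^2] each, while [X3]
    contributes [9 r^4] from its squared coefficient times [bumpC n / r^6] from the second
    derivative at scale [r^3]. *)
Lemma laplacian_cutoff_bound t x :
  `|laplacian [:: X1 R; X2 R; X3 R] (cutoff t) x| <=
  11 * bumpC n / r ^+ 2 * dome_tx t x ^+ n.+1.
Proof.
set M : R := bumpC n; set D := dome_x x ^+ n.+1.
have M0 : 0 <= M by rewrite mulr_ge0.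
have i2 : 0 <= (r ^+ 2)^-1 by rewrite invr_ge0 ltW.
have D0 : 0 <= D by rewrite exprn_ge0// dome_x_ge0.
(* The bound on the coefficient holds only in the box, but outside it [D] vanishes. *)
have qD : coefX3 x ^+ 2 * D <= 9 * r ^+ 4 * D.
  have [bx|nbx] := pselect (box x); first by rewrite ler_wpM2r// coefX3_bound.
  by rewrite /D dome_x_out// expr0n !mulr0.
rewrite laplacian_cutoff normrM /dome_tx exprMn -/D [leRHS]mulrCA.
apply: ler_pM => //; first exact: bump_bound.
set a0 := bump n 0 r x.1.1; set b0 := bump n 0 r x.1.2; set c0 := bump n 0 (r ^+ 3) x.2.
set a2 := bump2 n 0 r x.1.1; set b2 := bump2 n 0 r x.1.2; set c2 := bump2 n 0 (r ^+ 3) x.2.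
have A0 := bump_bound n 0 r x.1.1; have B0 := bump_bound n 0 r x.1.2.
have C0 := bump_bound n 0 (r ^+ 3) x.2.
have A2 := bump2_bound n 0 r0 x.1.1; have B2 := bump2_bound n 0 r0 x.1.2.
have C2 := bump2_bound n 0 r30 x.2.
have ED : D = dome 0 r x.1.1 ^+ n.+1 * dome 0 r x.1.2 ^+ n.+1 * dome 0 (r ^+ 3) x.2 ^+ n.+1.
  by rewrite /D /dome_x !exprMn.
have P3 (p q s p' q' s' : R) : `|p| <= p' -> `|q| <= q' -> `|s| <= s' ->
    `|p * q * s| <= p' * q' * s'.
  by move=> *; rewrite !normrM; apply: ler_pM; rewrite ?mulr_ge0//; apply: ler_pM.
have H1 : `|a2 * b0 * c0| <= M / r ^+ 2 * D.
  by rewrite (le_trans (P3 _ _ _ _ _ _ A2 B0 C0))// ED !mulrA.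
have H2 : `|a0 * b2 * c0| <= M / r ^+ 2 * D.
  rewrite (le_trans (P3 _ _ _ _ _ _ A0 B2 C0))// ED le_eqVlt; apply/orP; left.
  by apply/eqP; rewrite -/M; ring.
have H3 : `|a0 * b0 * c2| <= M / r ^+ 6 * D.
  rewrite (le_trans (P3 _ _ _ _ _ _ A0 B0 C2))// ED le_eqVlt; apply/orP; left.
  by apply/eqP; rewrite -/M; field; exact: lt0r_neq0.
rewrite (le_trans (ler_normD _ _))//.
rewrite (le_trans (lerD (ler_normD _ _) (lexx _)))//.
rewrite [`|coefX3 x ^+ 2 * _|]normrM (ger0_norm (sqr_ge0 _)).
have H4 : coefX3 x ^+ 2 * `|a0 * b0 * c2| <= 9 * M / r ^+ 2 * D.
  rewrite (le_trans (ler_wpM2l (sqr_ge0 _) H3))//.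
  rewrite mulrCA (le_trans (ler_wpM2l _ qD)) ?mulr_ge0 ?invr_ge0 ?exprn_ge0 ?(ltW r0)//.
  rewrite le_eqVlt; apply/orP; left; apply/eqP; field; exact: lt0r_neq0.
lra.
Qed.

End test.

(** * Iterated integrals *)

Section young.
Context {R : realType}.
Implicit Types (p a b w : R).

(** Young's inequality, whose factors [1 / p] and [1 / p'] are bounded by 1. *)
Lemma ge0_conjugate_powR p a b : 1 < p -> 0 <= a -> 0 <= b ->
  a * b <= a `^ p + b `^ (p / (p - 1)).
Proof.
move=> p1 a0 b0; have p0 : 0 < p by lra.
have q0 : 0 < p / (p - 1) by rewrite divr_gt0// subr_gt0.
have pq : p^-1 + (p / (p - 1))^-1 = 1.
  by rewrite invfM invrK; field; rewrite !lt0r_neq0// subr_gt0.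
rewrite (le_trans (conjugate_powR a0 b0 p0 q0 pq))// lerD//.
  by rewrite ler_piMr ?powR_ge0// invf_le1// ltW.
rewrite ler_piMr ?powR_ge0// invf_le1// ler_pdivlMr ?subr_gt0//; lra.
Qed.

(** Young's inequality is applied to [a w^(n+1)] and [b]. As [w] lies in [[0, 1]] and
    [(n + 1) p >= n + 3], the weight [w^((n+1) p)] is at most [w^(n+3)]. *)
Lemma powR_young n p a b w : 1 < p -> n.+3%:R <= n.+1%:R * p ->
  0 <= a -> 0 <= b -> 0 <= w <= 1 ->
  a * (b * w ^+ n.+1) <= a `^ p * w ^+ n.+3 + b `^ (p / (p - 1)).
Proof.
move=> p1 np a0 b0 /andP[w0 w1].
have h := ge0_conjugate_powR p1 (mulr_ge0 a0 (exprn_ge0 n.+1 w0)) b0.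
rewrite mulrCA mulrC; apply: le_trans h _; rewrite lerD2r powRM ?exprn_ge0//.
rewrite ler_wpM2l ?powR_ge0// -!powR_mulrn// -powRrM.
(* Monotonicity of powers in the exponent is applied to a positive base, so [w = 0] is treated
   apart. *)
move: w0; rewrite le_eqVlt => /predU1P[<-|w0].
  rewrite !powR0// ?gt_eqF// mulr_gt0//; lra.
by apply: ger_powR; rewrite ?w0.
Qed.
End young.

(** A sum equal to 0 in [\bar R] has only finite terms, so [c = - a - b - d <= - a + b' + d' <= k]
    is a computation in [R]. *)
Lemma ereal_absorb {R : realType} (a b c d e k b' d' : \bar R) :
  (b' + d' <= a + k -> `|d| <= d' -> `|b| <= b' -> e = 0 ->
    a + e + c + b + d = 0 -> c <= k)%E.
Proof.
move=> h1 h2 h3 -> E0; rewrite adde0 in E0.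
have : (a + c + b + d)%E \is a fin_num by rewrite E0.
rewrite !fin_numD => /andP[/andP[/andP[]]].
move: a c b d h1 h2 h3 E0 => [a||]// [c||]// [b||]// [d||]// h1 h2 h3 [E0] _ _ _ _.
move: k b' d' h1 h2 h3 => [k| |]; [|by rewrite leey|]; move=> [b'| |] [d'| |]//=.
rewrite -!EFinD !lee_fin => h1 h2 h3.
have := ler_norm (- b); have := ler_norm (- d); rewrite !normrN; lra.
Qed.

(** * Absorption in an identity between iterated integrals *)

Section iterated.
Local Open Scope ereal_scope.
Context d1 d2 (X : measurableType d1) (Y : measurableType d2) (R : realType).
Variables (mu : {measure set X -> \bar R}) (nu : {sigma_finite_measure set Y -> \bar R}).
Variable D : set X.
Hypothesis mD : measurable D.
Implicit Types (g h : X * Y -> \bar R).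

Definition iter_integral g := \int[mu]_(x in D) \int[nu]_y g (x, y).

Let measurable_inner g : measurable_fun [set: X * Y] g -> (forall z, 0 <= g z) ->
  measurable_fun D (fun x => \int[nu]_y g (x, y)).
Proof.
move=> mg g0; apply: (@measurable_funTS _ _ _ _ D).
exact: (measurable_fun_fubini_tonelli_F g mg g0).
Qed.

Let measurable_section g x : measurable_fun [set: X * Y] g ->
  measurable_fun [set: Y] (fun y => g (x, y)).
Proof. by move=> mg; apply: (measurableT_comp mg); exact: pair1_measurable. Qed.

Lemma ge0_iter_integralD g h :
    measurable_fun [set: X * Y] g -> measurable_fun [set: X * Y] h ->
    (forall z, 0 <= g z) -> (forall z, 0 <= h z) ->
  iter_integral (fun z => g z + h z) = iter_integral g + iter_integral h.
Proof.
move=> mg mh g0 h0; rewrite /iter_integral -ge0_integralD//.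
- apply: eq_integral => x _; rewrite ge0_integralD//; exact: measurable_section.
- by move=> x _; exact: integral_ge0.
- exact: measurable_inner.
- by move=> x _; exact: integral_ge0.
- exact: measurable_inner.
Qed.

Lemma ge0_le_iter_integral g h :
    measurable_fun [set: X * Y] g -> measurable_fun [set: X * Y] h ->
    (forall z, 0 <= g z) -> (forall x y, D x -> g (x, y) <= h (x, y)) ->
    (forall z, 0 <= h z) ->
  iter_integral g <= iter_integral h.
Proof.
move=> mg mh g0 gh h0; apply: ge0_le_integral => //.
- by move=> x _; exact: integral_ge0.
- exact: measurable_inner.
- exact: measurable_inner.
- move=> x Dx; apply: ge0_le_integral => //; try exact: measurable_section.
  by move=> y _; exact: gh.
Qed.

Lemma le_abse_iter_integral g : measurable_fun [set: X * Y] g ->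
  `|iter_integral g| <= iter_integral (fun z => `|g z|).
Proof.
move=> mg.
have mG : measurable_fun D (fun x => \int[nu]_y g (x, y)).
  (* Tonelli's theorem gives measurability of the inner integral for non-negative integrands, hence
     the splitting into positive and negative parts. *)
  rewrite (_ : (fun x => _) = (fun x => \int[nu]_y g^\+ (x, y)) \-
                             (fun x => \int[nu]_y g^\- (x, y))); last first.
    apply/funext => x; rewrite integralE.
    by congr (_ - _); apply: eq_integral => y _; rewrite ?funeposE ?funenegE.
  apply: emeasurable_funB; [apply: (@measurable_inner g^\+)|apply: (@measurable_inner g^\-)] => //.
  - exact: measurable_funepos.
  - exact: measurable_funeneg.
rewrite (le_trans (le_abse_integral _ mD mG))//; apply: ge0_le_integral => //.
- exact: measurableT_comp.
- by apply: (@measurable_inner (fun z => `|g z|)) => //; exact: measurableT_comp.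
- by move=> x _; apply: le_abse_integral => //; exact: measurable_section.
Qed.

(** This is the weak formulation in abstract form: [a] stands for [|u|^p psi], [E] for the initial
    term, [C] for the source, [b] and [c] for the terms with [psi_t] and the Laplacian. The
    pointwise bound lets [a] absorb [b] and [c] up to [k]. *)
Lemma iter_integral_absorb (a b c k : X * Y -> R) (C E : \bar R) :
    measurable_fun [set: X * Y] a -> measurable_fun [set: X * Y] b ->
    measurable_fun [set: X * Y] c -> measurable_fun [set: X * Y] k ->
    (forall z, (0 <= a z)%R) -> (forall z, (0 <= k z)%R) ->
    (forall x y, D x -> (`|b (x, y)| + `|c (x, y)| <= a (x, y) + k (x, y))%R) ->
  E = 0 ->
  iter_integral (EFin \o a) + E + C + iter_integral (EFin \o b)
    + iter_integral (EFin \o c) = 0 ->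
  C <= iter_integral (EFin \o k).
Proof.
move=> ma mb mc mk a0 k0 bck E0 sum0.
have mE (f : X * Y -> R) : measurable_fun [set: X * Y] f ->
    measurable_fun [set: X * Y] (EFin \o f).
  by move=> mf; exact/measurable_EFinP.
have mN (f : X * Y -> R) : measurable_fun [set: X * Y] f ->
    measurable_fun [set: X * Y] (fun z => `|(f z)%:E|).
  by move=> mf; apply: measurableT_comp => //; exact: mE.
have := le_abse_iter_integral (mE _ mb).
have := le_abse_iter_integral (mE _ mc).
have : iter_integral (fun z => `|(b z)%:E|) + iter_integral (fun z => `|(c z)%:E|)
   <= iter_integral (EFin \o a) + iter_integral (EFin \o k).
  rewrite -(ge0_iter_integralD (mN _ mb) (mN _ mc))//.
  rewrite -(ge0_iter_integralD (mE _ ma) (mE _ mk)); last 2 first.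
  - by move=> z; rewrite lee_fin.
  - by move=> z; rewrite lee_fin.
  apply: ge0_le_iter_integral => //.
  - by apply: emeasurable_funD; exact: mN.
  - by apply: emeasurable_funD; exact: mE.
  - by move=> z; rewrite adde_ge0.
  - by move=> z; rewrite /= lee_fin addr_ge0.
move=> h1 h2 h3; exact: ereal_absorb h1 h2 h3 E0 sum0.
Qed.

End iterated.

(** * The mass of the source *)

Section measurability.
Context {R : realType}.
Implicit Types (a b c : R -> R).

Lemma measurable_coord1 a : measurable_fun [set: measurableTypeR R] a ->
  measurable_fun [set: mR3 R] (fun x => a x.1.1).
Proof.
move=> ma; apply: (measurableT_comp ma).
exact: (measurableT_comp (@measurable_fst _ _ _ _) (@measurable_fst _ _ _ _)).
Qed.

Lemma measurable_coord2 a : measurable_fun [set: measurableTypeR R] a ->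
  measurable_fun [set: mR3 R] (fun x => a x.1.2).
Proof.
move=> ma; apply: (measurableT_comp ma).
exact: (measurableT_comp (@measurable_snd _ _ _ _) (@measurable_fst _ _ _ _)).
Qed.

Lemma measurable_coord3 a : measurable_fun [set: measurableTypeR R] a ->
  measurable_fun [set: mR3 R] (fun x => a x.2).
Proof.
by move=> ma; apply: (measurableT_comp ma); exact: (@measurable_snd _ _ _ _).
Qed.

Lemma measurable_tensor a b c : continuous a -> continuous b -> continuous c ->
  measurable_fun [set: mR3 R] (fun x => a x.1.1 * b x.1.2 * c x.2).
Proof.
move=> ca cb cc; apply: measurable_funM; [apply: measurable_funM|].
- by apply: (@measurable_coord1 _); exact: continuous_measurable_fun.
- by apply: (@measurable_coord2 _); exact: continuous_measurable_fun.
- by apply: (@measurable_coord3 _); exact: continuous_measurable_fun.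
Qed.

Lemma measurable_coefX3 : measurable_fun [set: mR3 R] (@coefX3 R).
Proof.
have m1 : measurable_fun [set: mR3 R] (fun x => x.1.1).
  exact: (measurable_coord1 (@measurable_id _ _ _)).
have m2 : measurable_fun [set: mR3 R] (fun x => x.1.2).
  exact: (measurable_coord2 (@measurable_id _ _ _)).
apply: measurable_funD; [apply: measurable_funD|].
- exact: measurable_funX.
- exact: measurable_funX.
- exact: measurable_funM.
Qed.

Lemma measurable_cutoff_x n (r : R) : measurable_fun [set: mR3 R] (cutoff_x n r).
Proof. by apply: measurable_tensor; exact: continuous_bump. Qed.

Lemma measurable_box (r : R) : measurable (box r : set (mR3 R)).
Proof. by apply: measurableX; [apply: measurableX|]; exact: measurable_itv. Qed.

Lemma leb3_box (r : R) : 0 <= r -> leb3 R (box r) = (8 * r ^+ 5)%:E.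
Proof.
move=> r0.
have L (s : R) : 0 <= s ->
    lebesgue_measure (`[- s, s]%classic : set (measurableTypeR R)) = (2 * s)%:E.
  move=> s0; rewrite lebesgue_measure_itv/= lte_fin.
  case: ltP => h; first by rewrite -EFinB; congr EFin; ring.
  have -> : s = 0 by lra.
  by rewrite mulr0.
have mI (s : R) : measurable (`[- s, s]%classic : set (measurableTypeR R)).
  exact: measurable_itv.
rewrite /leb3 /box product_measure1E//=; last exact: measurableX.
rewrite /leb2 product_measure1E//.
pose I (s : R) : set (measurableTypeR R) := `[- s, s]%classic.
rewrite -[LHS]/(lebesgue_measure (I r) * lebesgue_measure (I r)
  * lebesgue_measure (I (r ^+ 3)%R))%E /I.
rewrite !L ?exprn_ge0//.
by rewrite -!EFinM; congr EFin; ring.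
Qed.

End measurability.

(** * Positivity of the truncated mass *)

Section mass.
Context {R : realType}.
Variables (n : nat) (f : R3 R -> R).
Hypothesis mf : measurable_fun [set: mR3 R] f.
Implicit Types (x : R3 R) (r s : R).

Lemma cutoff_x_ge0 r x : 0 <= cutoff_x n r x.
Proof. by rewrite cutoff_xE exprn_ge0// dome_x_ge0. Qed.

Lemma dome_mono r r' s : 0 < r -> r <= r' -> dome 0 r s <= dome 0 r' s.
Proof.
move=> r0 rr'; rewrite /dome /relu ge_max le_max lexx/= le_max; apply/orP; right.
rewrite lerD2l lerN2 !subr0 !exprMn ler_wpM2l ?sqr_ge0//.
have r'0 := lt_le_trans r0 rr'.
by apply: lerXn2r; rewrite ?nnegrE ?invr_ge0 ?(ltW r0) ?(ltW r'0)// lef_pV2.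
Qed.

Lemma cutoff_x_mono r r' x : 0 < r -> r <= r' -> cutoff_x n r x <= cutoff_x n r' x.
Proof.
move=> r0 rr'; rewrite !cutoff_xE; apply: lerXn2r; rewrite ?nnegrE ?dome_x_ge0//.
have r'0 := lt_le_trans r0 rr'.
have d1 (s : R) : dome 0 r s <= dome 0 r' s by exact: dome_mono.
have d3 (s : R) : dome 0 (r ^+ 3) s <= dome 0 (r' ^+ 3) s.
  apply: dome_mono; rewrite ?exprn_gt0//.
  by apply: lerXn2r; rewrite ?nnegrE ?(ltW r0) ?(ltW r'0).
by apply: ler_pM; rewrite ?mulr_ge0 ?dome_ge0//; apply: ler_pM; rewrite ?dome_ge0.
Qed.

(** The value is squeezed between [1 - s^2 / (m + 1)] and 1. The cases [k = 0] and [k = 2] give the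
    widths [r] and [r^3]. *)
Lemma cvg_dome k s : (fun m : nat => dome 0 (m.+1%:R ^+ k.+1) s) @ \oo --> (1 : R).
Proof.
have L : (fun m : nat => 1 - s ^+ 2 * (@harmonic R m)) @ \oo --> (1 : R).
  rewrite -[X in _ --> X](subr0 1) -[X in 1 - X](mulr0 (s ^+ 2)).
  apply: cvgB; first exact: cvg_cst.
  by apply: cvgM; [exact: cvg_cst|exact: cvg_harmonic].
apply: (squeeze_cvgr _ L (cvg_cst _)).
near=> m; rewrite dome_le1 andbT /dome /relu le_max; apply/orP; right.
rewrite lerD2l lerN2 subr0 exprMn ler_wpM2l ?sqr_ge0// /harmonic -exprVn -exprM.
rewrite exprVn lef_pV2 ?posrE ?exprn_gt0//.
by rewrite ler_eXnr// ?ler1n.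
Unshelve. all: by end_near. Qed.

Lemma cvg_cutoff_x x : (fun m : nat => cutoff_x n m.+1%:R x) @ \oo --> (1 : R).
Proof.
rewrite (_ : (fun m => _) = (fun m => dome_x (m.+1%:R : R) x ^+ n.+3)); last first.
  by apply/funext => m; rewrite cutoff_xE.
have d : (fun m : nat => dome_x (m.+1%:R : R) x) @ \oo --> (1 : R).
  rewrite -[X in _ --> X](mulr1 1) -[X in X * 1](mulr1 1).
  have d0 := cvg_dome 0; rewrite /= in d0.
  apply: cvgM; [apply: cvgM|].
  - exact: d0.
  - exact: d0.
  - exact: cvg_dome.
have := @continuous_cvg _ _ _ _ _ _ (fun z : R => z ^+ n.+3) _
  (@exprn_continuous R n.+3 1) d.
by rewrite expr1n; apply.
Qed.

Let phi (m : nat) := cutoff_x n (m.+1%:R : R).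

Let phi_ge0 m x : 0 <= phi m x. Proof. exact: cutoff_x_ge0. Qed.

Let phi_le1 m x : phi m x <= 1.
Proof. by rewrite /phi cutoff_xE exprn_ile1// ?dome_x_ge0 ?dome_x_le1. Qed.

(** For the positive part of [f] the truncated integrals increase to the full one, which may be
    infinite; for the negative part they stay below the full integral since [phi m <= 1]. *)
Lemma mass_cutoff_pos : (0 < \int[leb3 R]_x (f x)%:E)%E ->
  exists (d : R) (N : nat), 0 < d /\
    forall m, (N <= m)%N -> (d%:E <= \int[leb3 R]_x (f x * phi m x)%:E)%E.
Proof.
pose fp x := Num.max (f x) 0; pose fn x := Num.max (- f x) 0.
have fp0 x : 0 <= fp x by rewrite le_max lexx orbT.
have fn0 x : 0 <= fn x by rewrite le_max lexx orbT.
have mfp : measurable_fun [set: mR3 R] fp.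
  by apply: measurable_maxr => //; exact: measurable_cst.
have mfn : measurable_fun [set: mR3 R] fn.
  apply: measurable_maxr; last exact: measurable_cst.
  exact: measurable_funN.
have mphi m : measurable_fun [set: mR3 R] (phi m) by exact: measurable_cutoff_x.
have Ef : (\int[leb3 R]_x (f x)%:E =
    \int[leb3 R]_x (fp x)%:E - \int[leb3 R]_x (fn x)%:E)%E.
  rewrite integralE; congr (_ - _)%E; apply: eq_integral => x _.
    by rewrite funeposE -EFin_max.
  by rewrite funenegE -EFinN -EFin_max.
have Efm m : (\int[leb3 R]_x (f x * phi m x)%:E =
    \int[leb3 R]_x (fp x * phi m x)%:E - \int[leb3 R]_x (fn x * phi m x)%:E)%E.
  rewrite integralE; congr (_ - _)%E; apply: eq_integral => x _.
    by rewrite funeposE -EFin_max maxr_pMl// mul0r.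
  by rewrite funenegE -EFinN -EFin_max maxr_pMl// mulNr mul0r.
pose g m x := (fp x * phi m x)%:E.
have mg m : measurable_fun [set: mR3 R] (g m).
  by apply/measurable_EFinP; exact: measurable_funM.
have g0 m x : [set: mR3 R] x -> (0 <= g m x)%E by move=> _; rewrite lee_fin mulr_ge0.
have gnd x : [set: mR3 R] x -> {homo g^~ x : m k / (m <= k)%N >-> (m <= k)%E}.
  move=> _ m k mk; rewrite lee_fin ler_wpM2l//.
  by apply: cutoff_x_mono; rewrite ?ltr0n// ler_nat.
have glim x : limn (g^~ x) = (fp x)%:E.
  apply/cvg_lim => //; apply/fine_cvgP; split; first exact: nearW.
  have := cvgM (cvg_cst (fp x)) (cvg_cutoff_x x); rewrite mulr1; exact.
have := @cvg_monotone_convergence _ _ _ (leb3 R) _ measurableT g mg g0 gnd.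
under eq_integral do rewrite glim.
move=> cg; rewrite Ef.
have nfn : (0 <= \int[leb3 R]_x (fn x)%:E)%E by apply: integral_ge0 => x _; rewrite lee_fin.
have fnm m : (\int[leb3 R]_x (fn x * phi m x)%:E <= \int[leb3 R]_x (fn x)%:E)%E.
  apply: ge0_le_integral => //.
  - by move=> x _; rewrite lee_fin mulr_ge0.
  - by apply/measurable_EFinP; exact: measurable_funM.
  - exact/measurable_EFinP.
  - by move=> x _; rewrite lee_fin ler_piMr.
have fnm0 m : (0 <= \int[leb3 R]_x (fn x * phi m x)%:E)%E.
  by apply: integral_ge0 => x _; rewrite lee_fin mulr_ge0.
move: nfn fnm cg; set P := (\int[leb3 R]_x (fp x)%:E)%E.
(* The negative part has a finite integral [q]: subtracting [+oo] gives [-oo] in [\bar R], even from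
   [+oo], against the positivity of the difference. *)
move: (\int[leb3 R]_x (fn x)%:E)%E => [q| |]// _ fnm cg; last by case: (P).
move=> Pq; have {Pq} [M qM MP] : exists2 M : R, q < M & (M%:E < P)%E.
  (* [M] is the midpoint of [q] and [P] when [P] is finite, and [q + 1] when [P] is infinite. *)
  move: Pq; case: (P) => [p| |]//; last by exists (q + 1); [lra|rewrite ltry].
  rewrite -EFinB lte_fin => pq; exists ((p + q) / 2); rewrite ?lte_fin; lra.
have /cg[N _ NP] : nbhs P [set y | (M%:E < y)%E].
  by apply: open_nbhs_nbhs; split => //; exact: open_ereal_gt_ereal.
exists (M - q), N; split; first by rewrite subr_gt0.
move=> m /NP /= Mm; rewrite Efm EFinB.
by apply: leeB; [exact: ltW|exact: fnm].
Qed.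

End mass.

(** * The estimate *)

Section estimate.
Context {R : realType}.
Variables (n : nat) (p r : R) (f : R3 R -> R) (u0 : R3 R -> R) (u : R -> R3 R -> R).
Hypothesis p1 : 1 < p.
Hypothesis np : n.+3%:R <= n.+1%:R * p.
Hypothesis r1 : 1 <= r.
Hypothesis lf : L1loc f.
Hypothesis usol : global_weak_solution [:: X1 R; X2 R; X3 R] p f u0 u.

Let r0 : 0 < r. Proof. exact: lt_le_trans r1. Qed.
Let r20 : 0 < r ^+ 2. Proof. exact: exprn_gt0. Qed.

Let D : set (measurableTypeR R) := otime +oo%E.

Let mD : measurable D.
Proof.
rewrite (_ : D = `]0, +oo[%classic); first exact: measurable_itv.
by apply/seteqP; split => t /=; rewrite /D /otime/= in_itv/= andbT ltry => // -[].
Qed.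

(** The function [u] is known to be measurable at positive times only; its extension by zero is
    measurable everywhere. *)
Let v : measurableTypeR R * mR3 R -> R := (fun z => u z.1 z.2) \_ (D `*` setT).

Let mv : measurable_fun [set: measurableTypeR R * mR3 R] v.
Proof.
have mDT : measurable (D `*` [set: mR3 R]) by exact: measurableX.
by apply/(measurable_restrictT _ mDT); exact: usol.1.1.
Qed.

Let vE t x : D t -> v (t, x) = u t x.
Proof. by move=> Dt; rewrite /v patchE mem_set. Qed.

Let m1 (a : R -> R) : continuous a ->
  measurable_fun [set: measurableTypeR R * mR3 R] (fun z => a z.1).
Proof.
move=> ca; have ma : measurable_fun [set: measurableTypeR R] a.
  exact: continuous_measurable_fun.
exact: (measurableT_comp ma (@measurable_fst _ _ _ _)).
Qed.

Let m2 (g : R3 R -> R) : measurable_fun [set: mR3 R] g ->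
  measurable_fun [set: measurableTypeR R * mR3 R] (fun z => g z.2).
Proof. by move=> mg; exact: (measurableT_comp mg (@measurable_snd _ _ _ _)). Qed.

Let lap := laplacian [:: X1 R; X2 R; X3 R].

Let a (z : measurableTypeR R * mR3 R) := `|v z| `^ p * cutoff n r z.1 z.2.
Let b (z : measurableTypeR R * mR3 R) := v z * derive1 (fun s : R => cutoff n r s z.2) z.1.
Let c (z : measurableTypeR R * mR3 R) := v z * lap (cutoff n r z.1) z.2.
(** The remainder in Young's inequality: [12 = 1 + 11] adds the constants of the bounds on the time
    derivative and on the Laplacian. *)
Let kap : R := (12 * bumpC n / r ^+ 2) `^ (p / (p - 1)).
Let J : set (measurableTypeR R) := `[r ^+ 2, 3 * r ^+ 2]%classic.
Let k (z : measurableTypeR R * mR3 R) : R :=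
  kap * (\1_J z.1 * \1_(box r : set (mR3 R)) z.2).

Let ma : measurable_fun setT a.
Proof.
apply: measurable_funM.
  apply: (measurableT_comp (measurable_powR p)).
  exact: measurableT_comp.
apply: measurable_funM; first by apply: m1; exact: continuous_bump.
by apply: m2; exact: measurable_cutoff_x.
Qed.

Let mb : measurable_fun setT b.
Proof.
apply: measurable_funM => //.
under eq_fun do rewrite derive1_cutoff//.
apply: measurable_funM; first by apply: m1; exact: continuous_bump1.
by apply: m2; exact: measurable_cutoff_x.
Qed.

Let mc : measurable_fun setT c.
Proof.
apply: measurable_funM => //.
pose G (x : R3 R) := bump2 n 0 r x.1.1 * bump n 0 r x.1.2 * bump n 0 (r ^+ 3) x.2
 + bump n 0 r x.1.1 * bump2 n 0 r x.1.2 * bump n 0 (r ^+ 3) x.2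
 + coefX3 x ^+ 2 * (bump n 0 r x.1.1 * bump n 0 r x.1.2 * bump2 n 0 (r ^+ 3) x.2).
have mG : measurable_fun [set: mR3 R] G.
  have T := measurable_tensor.
  have cb (s : R) : continuous (bump n 0 s) by exact: continuous_bump.
  have cb2 (s : R) : continuous (bump2 n 0 s) by exact: continuous_bump2.
  apply: measurable_funD; [apply: measurable_funD|apply: measurable_funM].
  - by apply: T; [exact: cb2|exact: cb|exact: cb].
  - by apply: T; [exact: cb|exact: cb2|exact: cb].
  - by apply: measurable_funX; exact: measurable_coefX3.
  - by apply: T; [exact: cb|exact: cb|exact: cb2].
rewrite (_ : (fun z => _) = fun z => cutoff_t n r z.1 * G z.2); last first.
  by apply/funext => z; rewrite /lap laplacian_cutoff.
by apply: measurable_funM; [apply: m1; exact: continuous_bump|exact: m2].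
Qed.

Let mJ : measurable J. Proof. exact: measurable_itv. Qed.

Let mk : measurable_fun setT k.
Proof.
apply: measurable_funM; first exact: measurable_cst.
apply: measurable_funM.
  exact: (measurableT_comp (measurable_indic mJ) (@measurable_fst _ _ _ _)).
exact: (measurableT_comp (measurable_indic (measurable_box r)) (@measurable_snd _ _ _ _)).
Qed.

Let kap0 : 0 <= kap. Proof. exact: powR_ge0. Qed.

Let k0 z : 0 <= k z.
Proof. by rewrite /k !mulr_ge0//. Qed.

Let a0 z : 0 <= a z.
Proof. by rewrite mulr_ge0 ?powR_ge0// cutoffE exprn_ge0// dome_tx_ge0. Qed.

(** On the support this is Young's inequality with weight [dome_tx]. Off [J] or off the box the
    weight vanishes, hence so do both terms on the left. *)
Let bck t x : `|b (t, x)| + `|c (t, x)| <= a (t, x) + k (t, x).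
Proof.
have M0 : 0 <= bumpC n :> R by rewrite mulr_ge0.
have i2 : 0 <= (r ^+ 2)^-1 by rewrite invr_ge0 ltW.
have H : `|b (t, x)| + `|c (t, x)| <=
    `|v (t, x)| * (12 * bumpC n / r ^+ 2 * dome_tx r t x ^+ n.+1).
  rewrite /b /c !normrM -mulrDr ler_wpM2l//=.
  have := derive1_cutoff_bound n r1 t x; have := laplacian_cutoff_bound n r1 t x.
  rewrite -/lap; lra.
rewrite (le_trans H)//.
have [Jt|nJt] := pselect (J t); last first.
  rewrite /dome_tx dome_eq0 ?mul0r ?expr0n ?mulr0 ?addr_ge0//.
  rewrite ltNge; apply/negP => h; apply: nJt; rewrite /J/= in_itv/=.
  by move: h; rewrite ler_distl => /andP[? ?]; apply/andP; split; lra.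
have [bx|nbx] := pselect (box r x); last first.
  by rewrite /dome_tx dome_x_out// mulr0 expr0n !mulr0 addr_ge0.
rewrite /k /= !indicE !mem_set// !mulr1 /a/= cutoffE.
apply: powR_young => //; first by rewrite !mulr_ge0.
by rewrite dome_tx_ge0 dome_tx_le1.
Qed.

Let iterE (g : measurableTypeR R * mR3 R -> R) (h : R -> R3 R -> R) :
    (forall t x, D t -> g (t, x) = h t x) ->
  iter_integral (@lebesgue_measure R) (leb3 R) D (EFin \o g) =
  (\int[@lebesgue_measure R]_(t in otime +oo%E) \int[leb3 R]_x (h t x)%:E)%E.
Proof.
move=> gh; apply: eq_integral => t /set_mem Dt.
by apply: eq_integral => x _ /=; rewrite gh.
Qed.

Lemma iter_source_le :
  (\int[@lebesgue_measure R]_(t in otime +oo%E) \int[leb3 R]_x (f x * cutoff n r t x)%:E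
    <= iter_integral (@lebesgue_measure R) (leb3 R) D (EFin \o k))%E.
Proof.
apply: (@iter_integral_absorb _ _ _ _ _ (@lebesgue_measure R) (leb3 R) D mD a b c k _
  (\int[leb3 R]_x (u0 x * cutoff n r 0 x)%:E)%E) => //.
  (* Time 0 lies at distance [2 r^2 > r^2] from the centre of [cutoff_t], so the initial term is
     0. *)
  apply: integral0_eq => x _; rewrite /cutoff cutoff_t_out ?mul0r ?mulr0//.
  by rewrite sub0r normrN gtr0_norm ?mulr_gt0// ltr_pMl// ltr1n.
have cutoff_ge0 t x : time +oo%E t -> 0 <= cutoff n r t x.
  by move=> _; rewrite cutoffE exprn_ge0// dome_tx_ge0.
have aE := @iterE a (fun t x => `|u t x| `^ p * cutoff n r t x).
have bE := @iterE b (fun t x => u t x * derive1 (fun s : R => cutoff n r s x) t).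
have cE := @iterE c (fun t x => u t x * lap (cutoff n r t) x).
have sol := usol.2 (cutoff n r) (test_cutoff n r1) cutoff_ge0.
rewrite aE; last by move=> t x Dt; rewrite /a vE.
rewrite bE; last by move=> t x Dt; rewrite /b vE.
rewrite cE; last by move=> t x Dt; rewrite /c vE.
exact: sol.
Qed.

Let lebesgue_segment (s t : R) : s <= t ->
  lebesgue_measure (`[s, t]%classic : set (measurableTypeR R)) = (t - s)%:E.
Proof.
move=> st; rewrite lebesgue_measure_itv/= lte_fin.
case: ltP => h; first by rewrite -EFinB.
by rewrite (_ : t - s = 0)//; lra.
Qed.

(** The box has volume [8 r^5] and [J] has length [2 r^2]. *)
Let iter_k_le : (iter_integral (@lebesgue_measure R) (leb3 R) D (EFin \o k) <=
   (kap * (16 * r ^+ 7))%:E)%E.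
Proof.
have inner t : (\int[leb3 R]_x (EFin \o k) (t, x) =
    (kap * (8 * r ^+ 5))%:E * (\1_J t)%:E)%E.
  under eq_integral => x _ do rewrite /k/= mulrA EFinM.
  rewrite ge0_integralZl//; last 2 first.
  - by apply/measurable_EFinP; apply: measurable_indic; exact: measurable_box.
  - by rewrite lee_fin mulr_ge0.
  rewrite integral_indic//; last exact: measurable_box.
  rewrite setIT -[X in (_ * X)%E]/(leb3 R (box r)) leb3_box ?(ltW r0)//.
  by rewrite -!EFinM; congr EFin; ring.
rewrite /iter_integral; under eq_integral => t _ do rewrite inner.
have K0 : 0 <= kap * (8 * r ^+ 5) by rewrite mulr_ge0// mulr_ge0// exprn_ge0// ltW.
rewrite ge0_integralZl//; last by apply/measurable_EFinP; exact: measurable_indic.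
rewrite integral_indic//.
have JD : (lebesgue_measure (J `&` D) <= (2 * r ^+ 2)%:E)%E.
  have <- : lebesgue_measure J = (2 * r ^+ 2)%:E.
    by rewrite lebesgue_segment; [congr EFin; ring|rewrite ler_peMl ?ltW// ltr1n].
  apply: le_measure; rewrite ?inE//; first exact: measurableI.
rewrite (le_trans (lee_wpmul2l _ JD))// -EFinM lee_fin.
rewrite le_eqVlt; apply/orP; left; apply/eqP; ring.
Qed.

(** The cutoff is at most 1 and vanishes off a compact box, so local integrability of [f] suffices.
    Integrability is what allows the factor [cutoff_t] to leave the spatial integral. *)
Let integrable_fphi : (leb3 R).-integrable setT (fun x => (f x * cutoff_x n r x)%:E).
Proof.
have mfphi : measurable_fun [set: mR3 R] (fun x => f x * cutoff_x n r x).
  by apply: measurable_funM; [exact: lf.1|exact: measurable_cutoff_x].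
apply/integrableP; split; first exact/measurable_EFinP.
have := lf.2 _ (@compact_box R r); apply: le_lt_trans.
rewrite [leRHS]integral_mkcond; apply: ge0_le_integral => //.
- by apply: measurableT_comp => //; exact/measurable_EFinP.
- apply/(measurable_restrictT _ (measurable_box r)).
  apply/measurable_EFinP; apply: measurable_funTS; apply: measurableT_comp => //.
  exact: lf.1.
- move=> x _; rewrite patchE; case: ifPn => [bx|]; last first.
    rewrite notin_setE => nbx; rewrite cutoff_xE dome_x_out// expr0n mulr0.
    by rewrite abse0.
  rewrite lee_fin normrM ler_piMr// ger0_norm ?cutoff_x_ge0//.
  by rewrite cutoff_xE exprn_ile1 ?dome_x_ge0 ?dome_x_le1.
Qed.

(** On the middle half [I] of the support in time, of length [r^2], the normalised distance to the
    centre is at most [1 / 2], so the dome is at least [1 - 1 / 4 = 3 / 4]. *)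
Let source_ge (d : R) : 0 < d ->
    (d%:E <= \int[leb3 R]_x (f x * cutoff_x n r x)%:E)%E ->
  (((3 / 4) ^+ n.+3 * d * r ^+ 2)%:E <=
    \int[@lebesgue_measure R]_(t in otime +oo%E) \int[leb3 R]_x (f x * cutoff n r t x)%:E)%E.
Proof.
move=> d0 dF; set F := (\int[leb3 R]_x _)%E in dF.
have inner t : (\int[leb3 R]_x (f x * cutoff n r t x)%:E = (cutoff_t n r t)%:E * F)%E.
  under eq_integral => x _ do rewrite /cutoff mulrCA EFinM.
  by rewrite integralZl.
under eq_integral => t _ do rewrite inner.
have F0 : (0 <= F)%E by rewrite (le_trans _ dF)// lee_fin ltW.
pose I : set (measurableTypeR R) := `[3 / 2 * r ^+ 2, 5 / 2 * r ^+ 2]%classic.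
have mI : measurable I by exact: measurable_itv.
have mcF : measurable_fun [set: measurableTypeR R] (fun t => (cutoff_t n r t)%:E * F)%E.
  apply: emeasurable_funM; last exact: measurable_cst.
  by apply/measurable_EFinP; apply: continuous_measurable_fun; exact: continuous_bump.
have cF0 t : (0 <= (cutoff_t n r t)%:E * F)%E by rewrite mule_ge0// lee_fin bump_ge0.
have ID : I `<=` D.
  move=> t; rewrite /I/= in_itv/= => /andP[It _]; split; last exact: ltry.
  by rewrite (lt_le_trans _ It)// mulr_gt0.
apply: le_trans (@ge0_subset_integral _ _ _ (@lebesgue_measure R) I D mI mD _ _ _ ID);
  [|exact: measurable_funTS|by []].
have -> : ((3 / 4) ^+ n.+3 * d * r ^+ 2)%:E =
    (\int[@lebesgue_measure R]_(t in I) cst ((3 / 4) ^+ n.+3 * d)%:E t)%E.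
  rewrite integral_cst// -[X in (_ * X)%E]/(lebesgue_measure I) lebesgue_segment; last first.
    by rewrite ler_pM2r//; lra.
  by rewrite -EFinM; congr EFin; field.
apply: ge0_le_integral => //.
- by move=> t _; rewrite lee_fin mulr_ge0 ?exprn_ge0 ?divr_ge0// ltW.
- exact: measurable_funTS.
- move=> t; rewrite /I/= in_itv/= => It; rewrite EFinM.
  apply: lee_pmul => //; [by rewrite lee_fin ltW|].
  rewrite lee_fin /cutoff_t /bump; apply: lerXn2r; rewrite ?nnegrE ?divr_ge0 ?dome_ge0//.
  rewrite /dome /relu le_max; apply/orP; right.
  have h : `|(t - 2 * r ^+ 2) / r ^+ 2| <= 1 / 2.
    rewrite normrM normfV (gtr0_norm r20) ler_pdivrMr// ler_distl.
    by apply/andP; split; lra.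
  have : `|(t - 2 * r ^+ 2) / r ^+ 2| ^+ 2 <= (1 / 2) ^+ 2.
    by apply: lerXn2r; rewrite ?nnegrE ?divr_ge0.
  rewrite real_normK ?num_real//; lra.
Qed.

(** The condition [p < 3 / 2] gives [p / (p - 1) >= 3], and [r >= 1] then gives [kap <= B r^-6]. The
    upper bound of order [r^7 r^-6 = r] meets a lower bound of order [r^2], and one factor [r]
    cancels. *)
Lemma mass_le (d : R) : p < 3 / 2 -> 0 < d ->
    (d%:E <= \int[leb3 R]_x (f x * cutoff_x n r x)%:E)%E ->
  (3 / 4) ^+ n.+3 * d * r <= 16 * (12 * bumpC n) `^ (p / (p - 1)).
Proof.
move=> p32 d0 /(source_ge d0) h.
have := le_trans h (le_trans iter_source_le iter_k_le); rewrite lee_fin.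
have q3 : 3%:R <= p / (p - 1) by rewrite ler_pdivlMr ?subr_gt0//; lra.
have M0 : 0 <= 12 * bumpC n :> R by rewrite !mulr_ge0.
have i2 : 0 < (r ^+ 2)^-1 by rewrite invr_gt0.
set B := (12 * bumpC n) `^ _.
have kB : kap <= B * (r ^+ 6)^-1.
  rewrite /kap powRM//; last exact: ltW.
  rewrite ler_wpM2l ?powR_ge0//.
  rewrite (_ : (r ^+ 6)^-1 = ((r ^+ 2)^-1) `^ 3%:R); last first.
    by rewrite powR_mulrn ?(ltW i2)// exprVn -exprM.
  by apply: ger_powR => //; rewrite i2 invf_le1// exprn_ege1.
move=> H; have r7 : 0 <= 16 * r ^+ 7 by rewrite mulr_ge0// exprn_ge0// ltW.
have := le_trans H (ler_wpM2r r7 kB).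
rewrite (_ : B * _ * _ = 16 * B * r); last by field; exact: lt0r_neq0.
by rewrite expr2 mulrA ler_pM2r.
Qed.

End estimate.

(** * The contradiction at large scales *)

Theorem theorem4p7 (R : realType) (p : R) (f u0 : R3 R -> R)
    (hp1 : 1 < p) (hp2 : p < 3%:R / 2%:R)
    (hu0 : L1loc u0) (hf : L1loc f)
    (hfpos : (0 < \int[leb3 R]_x (f x)%:E)%E) :
  ~ exists u : R -> R3 R -> R,
      global_weak_solution [:: X1 R; X2 R; X3 R] p f u0 u.
Proof.
case=> u usol.
have [n np] : exists n : nat, n.+3%:R <= n.+1%:R * p.
  (* This choice gives [(n + 1) (p - 1) > 2], that is [(n + 1) p > n + 3]. *)
  exists (Num.trunc (2 / (p - 1))).
  have := truncnS_gt (2 / (p - 1)); rewrite ltr_pdivrMr ?subr_gt0//.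
  rewrite -!natr1; lra.
have [d [N [d0 dN]]] := mass_cutoff_pos n hf.1 hfpos.
(* By [mass_le] no admissible scale can exceed [K]; the scale [m + 1] does, with [m >= N] so that
   the mass is at least [d]. *)
pose K := 16 * (12 * bumpC n) `^ (p / (p - 1)) / ((3 / 4) ^+ n.+3 * d).
have c0 : 0 < (3 / 4) ^+ n.+3 * d :> R by rewrite mulr_gt0// exprn_gt0 ?divr_gt0.
pose m := maxn N (Num.trunc K).
have Km : K < m.+1%:R.
  by rewrite (lt_le_trans (truncnS_gt K))// ler_nat ltnS leq_maxr.
have m1 : 1 <= m.+1%:R :> R by rewrite ler1n.
move: Km; rewrite /K ltr_pdivrMr// [ltRHS]mulrC ltNge => /negP; apply.
apply: (@mass_le R n p m.+1%:R f u0 u) => //.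
by apply: dN; rewrite leq_maxl.
Qed.
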